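(* Let $\epsilon>0$ and $\delta\in(0,1)$, and let $M=\max_{c\in C}\max_{v\in V} f_c(v\mid\emptyset)>0$. If $\mathrm{OPT}\ge\frac{4}{\epsilon^2}M\log(2k)$, then Algorithm 2 with failure parameter $\delta$ outputs a set $S$ with $|S|\le B$ such that \[ \min_{c\in C} f_c(S)\;\ge\;\left(1-\frac1e-\epsilon\right)\mathrm{OPT} \] with probability at least $1-\delta$.
   Context: Setup: $V$ is a finite nonempty ground set, $C$ is a finite nonempty set of ''colors'', $k=|C|$. For each $c\in C$, $f_c\colon 2^V\to\mathbb{R}_{\ge 0}$ is monotone and submodular. $B$ is a positive integer (the budget). $f(T\mid S)=f(S\cup T)-f(S)$ and $f(v\mid S)=f(\{v\}\mid S)$. $\mathrm{OPT}=\max_{S\subseteq V,\,|S|\le B}\min_{c\in C} f_c(S)$. $\Delta_V$ is the probability simplex over $V$; $\log$ is the natural logarithm unless indicated. $\mathrm{LP}(S)$ is the linear program in variables $\xi\in\mathbb{R}$, $x\in\mathbb{R}^V$: maximize $\xi$ subject to $\sum_{v\in V} x_v\,(B f_c(v\mid S)+f_c(S))\ge \xi$ for all $c\in C$, $\sum_{v\in V}x_v=1$, $x_v\ge 0$ for all $v\in V$. Algorithm 2 (input: the $f_c$, $B$, $\delta$): set $S_{\mathrm{best}}=\emptyset$. Repeat, with independent randomness, $\lceil\log_2(2/\delta)\rceil$ times: set $S^{(0)}=\emptyset$; for $i=1,\dots,B$: let $x^{(i)}\in\Delta_V$ be (the $x$-part of) an optimal solution of $\mathrm{LP}(S^{(i-1)})$,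 sample $v^{(i)}\sim x^{(i)}$, set $S^{(i)}=S^{(i-1)}\cup\{v^{(i)}\}$; then if $\min_{c}f_c(S^{(B)})\ge\min_c f_c(S_{\mathrm{best}})$ set $S_{\mathrm{best}}=S^{(B)}$. Output $S_{\mathrm{best}}$. *)

(* Defs.v *)
From mathcomp Require Import all_boot all_order all_algebra.
From mathcomp Require Import reals sequences exp.
Set Implicit Arguments. Unset Strict Implicit. Unset Printing Implicit Defensive.
Import Order.TTheory GRing.Theory Num.Theory.
Local Open Scope ring_scope.

Section Defs.
Variables (R : realType) (V C : finType).

(* minimum over the (nonempty) finite color set; for empty C the value is 0
   (irrelevant: the theorem assumes C nonempty). *)
Definition minC (g : C -> R) : R :=
  let s := [seq g c | c <- enum C] in \big[Num.min/head 0 s]_(x <- s) x.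

Variable f : C -> {set V} -> R.

Definition margS (c : C) (T S : {set V}) : R := f c (S :|: T) - f c S.
Definition marg (c : C) (v : V) (S : {set V}) : R := margS c [set v] S.

Definition nonneg_fam := forall c S, 0 <= f c S.
Definition monotone_fam := forall c (S T : {set V}), S \subset T -> f c S <= f c T.
Definition submodular_fam :=
  forall c (S T : {set V}), f c (S :|: T) + f c (S :&: T) <= f c S + f c T.

Definition minf (S : {set V}) : R := minC (fun c => f c S).

Definition OPT (B : nat) : R :=
  \big[Num.max/minf set0]_(S : {set V} | (#|S| <= B)%N) minf S.

(* M = max_c max_v f_c(v | emptyset) ; all terms are >= 0 under monotonicity *)
Definition Mconst : R := \big[Num.max/0]_(c : C) \big[Num.max/0]_(v : V) marg c v set0.

(* the LP(S): x in the simplex, objective = max xi s.t. all color constraints,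
   i.e. the value of x is min_c sum_v x_v (B f_c(v|S) + f_c(S)). *)
Definition in_simplex (x : V -> R) := (forall v, 0 <= x v) /\ \sum_(v : V) x v = 1.
Definition lp_val (B : nat) (S : {set V}) (x : V -> R) : R :=
  minC (fun c => \sum_(v : V) x v * (B%:R * marg c v S + f c S)).
Definition lp_opt (B : nat) (S : {set V}) (x : V -> R) :=
  in_simplex x /\ forall y, in_simplex y -> lp_val B S y <= lp_val B S x.

(* An LP-solver policy: for repetition j and history h (the sequence of
   elements sampled so far in that repetition), sol j h is the x^{(i)} used. *)
Definition valid_policy (B : nat) (sol : nat -> seq V -> V -> R) :=
  forall j h, lp_opt B [set v in h] (sol j h).

Definition run_prob (B : nat) (sol : nat -> seq V -> V -> R) (j : nat)
  (t : B.-tuple V) : R :=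
  \prod_(i < B) sol j (take i t) (tnth t i).

Definition run_set (B : nat) (t : B.-tuple V) : {set V} := [set v in t].

Definition nreps (delta : R) : nat := `|Num.ceil (ln (2 / delta) / ln 2)|%N.

Definition alg_output (B n : nat) (w : {ffun 'I_n -> B.-tuple V}) : {set V} :=
  foldl (fun Sb S => if minf Sb <= minf S then S else Sb) set0
        [seq run_set (w j) | j <- enum 'I_n].

Definition outcome_prob (B n : nat) (sol : nat -> seq V -> V -> R)
  (w : {ffun 'I_n -> B.-tuple V}) : R :=
  \prod_(j < n) run_prob sol j (w j).

Definition alg_prob (B : nat) (delta : R) (sol : nat -> seq V -> V -> R)
  (P : {set V} -> bool) : R :=
  \sum_(w : {ffun 'I_(nreps delta) -> B.-tuple V} | P (alg_output w))
     outcome_prob sol w.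

End Defs.

(* Main.v *)
(** A uniformly random element of an optimal set is feasible for [LP(S)], so
    the sampled element [v] satisfies [E f_c(v | S) >= (OPT - f_c(S)) / B].
    Since marginals lie in [[0, M]], [exp (a_n (OPT - f_c(S)))] is a
    supermartingale when the rates follow, in the number [n] of remaining
    steps, [a_(n+1) = a_n - a_n / ((1 + a_n M) B)].  Starting from
    [a_0 = eps / (2 M)], one gets [a_B <= a_0 / e + a_0^2 M], and Markov's
    inequality bounds the failure probability of a color by [1 / (2 k)].  A
    union bound makes each repetition fail with probability at most [1 / 2],
    and independence multiplies these bounds. *)
Require Import Defs.
From mathcomp Require Import all_boot all_order all_algebra.
From mathcomp Require Import reals sequences exp.
From mathcomp Require Import ring lra.
Set Implicit Arguments. Unset Strict Implicit. Unset Printing Implicit Defensive.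
Import Order.TTheory GRing.Theory Num.Theory.
Local Open Scope ring_scope.

(** * Color minima, the optimum and marginal gains *)

Lemma minC_le (R : realType) (C : finType) (g : C -> R) (c : C) :
  Defs.minC g <= g c.
Proof. by rewrite /Defs.minC big_map big_enum /=; apply: bigmin_le_cond. Qed.

Lemma le_minC (R : realType) (C : finType) (g : C -> R) (x : R) :
  (0 < #|C|)%N -> (forall c, x <= g c) -> x <= Defs.minC g.
Proof.
move=> C0 gx; rewrite /Defs.minC big_map; apply: le_bigmin => //.
(* With a color present, the default [head 0 s] is itself a value of [g]. *)
by move: C0; rewrite cardE; case: (enum C) => [|c s] //= _; exact: gx.
Qed.

Lemma OPT_attained (R : realType) (V C : finType) (f : C -> {set V} -> R) B :
  exists2 S : {set V}, (#|S| <= B)%N & OPT f B = minf f S.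
Proof.
rewrite /OPT; elim/big_ind: _ => [|x y [S SB ->] [T TB ->]|S SB].
- by exists set0; rewrite ?cards0.
- by rewrite maxEle; case: ifP => _; [exists T|exists S].
- by exists S.
Qed.

Lemma marg_ge0 (R : realType) (V C : finType) (f : C -> {set V} -> R) c v S :
  monotone_fam f -> 0 <= marg f c v S.
Proof. by move=> mf; rewrite subr_ge0; apply: mf; apply: subsetUl. Qed.

(** Diminishing returns: submodularity for [S] and [[set v]] shows that the gain of [v] is largest
    at [set0]. *)
Lemma marg_le_Mconst (R : realType) (V C : finType) (f : C -> {set V} -> R)
    c v S :
  monotone_fam f -> submodular_fam f -> marg f c v S <= Mconst f.
Proof.
move=> mf sf; apply: (@le_trans _ _ (marg f c v set0)); last first.
  apply: le_trans (le_bigmax 0 _ c).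
  exact: (le_bigmax 0 (fun v => marg f c v set0) v).
rewrite /marg /margS set0U.
have := sf c S [set v]; have := mf c _ _ (sub0set (S :&: [set v])).
lra.
Qed.

(** Add the elements of [T] one at a time: submodularity is applied to two supersets of [S], whose
    intersection still contains [S]. *)
Lemma submodular_le_sum_marg (R : realType) (V C : finType)
    (f : C -> {set V} -> R) c (S T : {set V}) :
  monotone_fam f -> submodular_fam f ->
  f c (S :|: T) <= f c S + \sum_(v in T) marg f c v S.
Proof.
move=> mf sf; rewrite -big_enum /= -[in X in X <= _](set_enum T).
elim: (enum T) => [|v s IH].
  have -> : [set x in [::]] = set0 :> {set V} by apply/setP => x; rewrite !inE.
  by rewrite big_nil addr0 setU0.
rewrite big_cons (_ : S :|: [set x in v :: s] =
    (S :|: [set x in s]) :|: (S :|: [set v])); last first.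
  by apply/setP => x; rewrite !inE; case: (x \in S) => //=; rewrite orbC.
have := sf c (S :|: [set x in s]) (S :|: [set v]).
have : f c S <= f c ((S :|: [set x in s]) :&: (S :|: [set v])).
  by apply: mf; rewrite subsetI !subsetUl.
by move: IH; rewrite /marg /margS; lra.
Qed.

(** * Mean gain under an optimal LP solution *)

Lemma simplex_mean (R : realType) (V : finType) (x : V -> R) (a b : R)
    (D : V -> R) :
  in_simplex x ->
  \sum_v x v * (a * D v + b) = a * (\sum_v x v * D v) + b.
Proof.
case=> _ x1; rewrite -[X in _ = _ + X]mulr1 -x1 !mulr_sumr -big_split /=.
by apply: eq_bigr => v _; ring.
Qed.

Lemma simplex_inhabited (R : realType) (V : finType) (v : V) :
  exists x : V -> R, in_simplex x.
Proof.
exists (fun u => (u == v)%:R); split => [u|]; first by rewrite ler0n.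
rewrite (bigD1 v) //= eqxx big1 ?addr0 // => u uv.
by rewrite (negbTE uv).
Qed.

(* The uniform distribution on an optimal set is a feasible LP solution. *)
Lemma exists_lp_val_ge_OPT (R : realType) (V C : finType)
    (f : C -> {set V} -> R) (B : nat) (S : {set V}) :
  (0 < #|V|)%N -> (0 < #|C|)%N -> monotone_fam f -> submodular_fam f ->
  exists2 y : V -> R, in_simplex y & OPT f B <= lp_val f B S y.
Proof.
move=> /card_gt0P[v0 _] C0 mf sf.
have [T TB ->] := OPT_attained f B.
(* An empty optimal set has no uniform distribution; then any point of the simplex works, because
   [f c set0 <= f c S]. *)
have [T0|T0] := posnP #|T|.
  have [y ys] := simplex_inhabited R v0; exists y => //.
  apply: le_minC => // c; rewrite simplex_mean //.
  apply: le_trans (minC_le _ c) _; rewrite (cards0_eq T0).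
  have := mf c _ _ (sub0set S).
  have : 0 <= B%:R * \sum_v y v * marg f c v S.
    apply: mulr_ge0 => //; apply: sumr_ge0 => v _.
    by apply: mulr_ge0; [exact: ys.1|exact: marg_ge0].
  lra.
have Tpos : 0 < #|T|%:R :> R by rewrite ltr0n.
pose y v : R := if v \in T then #|T|%:R^-1 else 0.
have ysum (D : V -> R) : \sum_v y v * D v = #|T|%:R^-1 * \sum_(v in T) D v.
  rewrite mulr_sumr [RHS]big_mkcond /=.
  by apply: eq_bigr => v _; rewrite /y; case: ifP; rewrite ?mul0r.
have ys : in_simplex y.
  split=> [v|]; first by rewrite /y; case: ifP; rewrite ?invr_ge0.
  transitivity (\sum_v y v * 1); first by apply: eq_bigr => v _; rewrite mulr1.
  by rewrite ysum sumr_const mulVf // gt_eqF.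
exists y => //; apply: le_minC => // c; rewrite simplex_mean // ysum.
apply: le_trans (minC_le _ c) _.
have sge0 : 0 <= \sum_(v in T) marg f c v S.
  by apply: sumr_ge0 => v _; exact: marg_ge0.
have : \sum_(v in T) marg f c v S <=
    B%:R * (#|T|%:R^-1 * \sum_(v in T) marg f c v S).
  by rewrite mulrA ler_peMl // ler_pdivlMr // mul1r ler_nat.
have := mf c _ _ (subsetUr S T).
have := submodular_le_sum_marg c S T mf sf.
lra.
Qed.

(** By optimality [x] does at least as well as the solution of value [OPT]; the constraint of color
    [c] is then solved for the mean gain. *)
Lemma lp_opt_mean_marg_ge (R : realType) (V C : finType)
    (f : C -> {set V} -> R) (B : nat) (S : {set V}) (x : V -> R) (c : C) :
  (0 < #|V|)%N -> (0 < B)%N -> monotone_fam f -> submodular_fam f ->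
  lp_opt f B S x ->
  (OPT f B - f c S) / B%:R <= \sum_v x v * marg f c v S.
Proof.
move=> V0 B0 mf sf [xs xopt].
have C0 : (0 < #|C|)%N by apply/card_gt0P; exists c.
have [y ys /le_trans] := exists_lp_val_ge_OPT B S V0 C0 mf sf.
move=> /(_ _ (xopt y ys)) /le_trans /(_ (minC_le _ c)).
rewrite simplex_mean // => H.
by rewrite ler_pdivrMr ?ltr0n // mulrC lerBlDr.
Qed.

(** * One-step decay of the exponential potential *)

(* [e^(-aD) <= 1 / (1 + aD) = 1 - aD / (1 + aD)], and [D <= M]. *)
Lemma expRN_le_chord (R : realType) (a D M : R) :
  0 <= a -> 0 <= D -> D <= M -> expR (- (a * D)) <= 1 - a / (1 + a * M) * D.
Proof.
move=> a0 D0 DM.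
have aD0 : 0 <= a * D by apply: mulr_ge0.
have aDM : a * D <= a * M by apply: ler_wpM2l.
have p1 : 0 < 1 + a * D by lra.
have p2 : 0 < 1 + a * M by lra.
apply: (@le_trans _ _ (1 + a * D)^-1).
  rewrite expRN lef_pV2 ?posrE ?expR_gt0 //; exact: expR_ge1Dx.
have -> : 1 - a / (1 + a * M) * D = (1 + a * M - a * D) / (1 + a * M).
  by field; rewrite gt_eqF.
rewrite -div1r ler_pdivrMr // mulrAC ler_pdivlMr //; nra.
Qed.

(** Averaging the chord bound over [v] produces the factor [1 - r * m], and [m >= Y / B] with
    [1 + z <= expR z] turns it into a smaller rate. The sign of [Y] is free, so a color may already
    exceed [OPT]. *)
Lemma expR_potential_step (R : realType) (V C : finType)
    (f : C -> {set V} -> R) (B : nat) (x : V -> R) (c : C) (a : R) (h : seq V) :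
  (0 < #|V|)%N -> (0 < B)%N -> monotone_fam f -> submodular_fam f ->
  0 <= Mconst f -> 0 <= a -> lp_opt f B [set v in h] x ->
  \sum_v x v * expR (a * (OPT f B - f c [set u in rcons h v])) <=
  expR ((a - a / ((1 + a * Mconst f) * B%:R)) * (OPT f B - f c [set u in h])).
Proof.
move=> V0 B0 mf sf M0 a0 xo.
have := lp_opt_mean_marg_ge c V0 B0 mf sf xo.
set S := [set v in h]; set M := Mconst f in M0 *; set Y := OPT f B - f c S.
set m := \sum_v _ => Ym.
have aM0 : 0 <= a * M by apply: mulr_ge0.
pose r := a / (1 + a * M).
have r0 : 0 <= r by apply: divr_ge0 => //; lra.
apply: (@le_trans _ _ (expR (a * Y) * (1 - r * m))).
  have -> : 1 - r * m = \sum_v x v * ((- r) * marg f c v S + 1).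
    by rewrite simplex_mean -/m; [ring|exact: xo.1].
  rewrite mulr_sumr; apply: ler_sum => v _.
  have -> : [set u in rcons h v] = S :|: [set v].
    by apply/setP => u; rewrite !inE mem_rcons inE orbC.
  rewrite mulrCA ler_wpM2l ?xo.1.1 //.
  have -> : a * (OPT f B - f c (S :|: [set v])) = a * Y + - (a * marg f c v S).
    by rewrite /Y /marg /margS; ring.
  rewrite expRD ler_wpM2l ?expR_ge0 //.
  have := expRN_le_chord a0 (marg_ge0 c v S mf)
    (marg_le_Mconst c v S mf sf).
  by rewrite -/r; lra.
have -> : (a - a / ((1 + a * M) * B%:R)) * Y = a * Y + - (r * (Y / B%:R)).
  by rewrite /r; field; rewrite pnatr_eq0 -lt0n B0 gt_eqF //; lra.
rewrite expRD ler_wpM2l ?expR_ge0 //.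
apply: le_trans (expR_ge1Dx _).
by rewrite lerD2l lerN2 ler_wpM2l.
Qed.

(** * The recursion for the rates *)

Fixpoint rate (R : realType) (M b a : R) (n : nat) : R :=
  if n is m.+1 then
    let r := rate M b a m in r - r / ((1 + r * M) * b)
  else a.

Lemma rate_bounds (R : realType) (M b a : R) n :
  0 <= M -> 1 <= b -> 0 <= a -> 0 <= rate M b a n <= a.
Proof.
move=> M0 b1 a0; elim: n => [|n /andP[r0 ra]] /=; first by rewrite a0 lexx.
set r := rate _ _ _ _ in r0 ra *.
have d1 : 1 <= (1 + r * M) * b by have := mulr_ge0 r0 M0; nra.
have d0 : 0 < (1 + r * M) * b by lra.
have q0 : 0 <= r / ((1 + r * M) * b) by apply: divr_ge0 => //; lra.
have q1 : r / ((1 + r * M) * b) <= r by rewrite ler_pdivrMr // ler_peMr.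
by apply/andP; split; lra.
Qed.

(** The right side solves the linear recursion [u_(n+1) = (1 - 1/b) u_n + a^2 M / b] with [u_0 = a];
    each rate step is such a combination with [r^2 M / (1 + r M) <= a^2 M] in the last term. *)
Lemma rate_le (R : realType) (M b a : R) n :
  0 <= M -> 1 <= b -> 0 <= a ->
  rate M b a n <= a * (1 - b^-1) ^+ n + a ^+ 2 * M * (1 - (1 - b^-1) ^+ n).
Proof.
move=> M0 b1 a0; elim: n => [|n IH] /=; first by rewrite expr0; lra.
have /andP[] := rate_bounds n M0 b1 a0.
set r := rate _ _ _ _ in IH *; set q := (1 - b^-1) ^+ n in IH * => r0 ra.
have rM := mulr_ge0 r0 M0.
have bV0 : 0 <= b^-1 by rewrite invr_ge0; lra.
have bV1 : b^-1 <= 1 by rewrite invf_le1 //; lra.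
have d0 : 0 < 1 + r * M by lra.
have -> : r - r / ((1 + r * M) * b) =
    (1 - b^-1) * r + b^-1 * (r ^+ 2 * M / (1 + r * M)).
  by field; rewrite !gt_eqF //; lra.
have H1 : r ^+ 2 * M / (1 + r * M) <= a ^+ 2 * M.
  apply: (@le_trans _ _ (r ^+ 2 * M)).
    have r2 : 0 <= r ^+ 2 * M by apply: mulr_ge0 => //; apply: sqr_ge0.
    by rewrite ler_pdivrMr // ler_peMr //; lra.
  by apply: ler_wpM2r => //; rewrite lerXn2r ?nnegrE.
have H2 := ler_wpM2l bV0 H1.
have q0 : 0 <= 1 - b^-1 by lra.
have H3 := ler_wpM2l q0 IH.
rewrite (exprS _ n) -/q; apply: (le_trans (lerD H3 H2)).
by rewrite le_eqVlt; apply/orP; left; apply/eqP; ring.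
Qed.

Lemma expr_1subV_le_expRN1 (R : realType) (B : nat) :
  (0 < B)%N -> (1 - B%:R^-1) ^+ B <= expR (-1) :> R.
Proof.
move=> B0; have b0 : 0 < B%:R :> R by rewrite ltr0n.
have bV1 : B%:R^-1 <= 1 :> R by rewrite invf_le1 // ler1n.
have -> : -1 = B%:R * - B%:R^-1 :> R by rewrite mulrN mulfV // gt_eqF.
rewrite expRM_natl lerXn2r ?nnegrE ?expR_ge0 //; first by lra.
by apply: le_trans (expR_ge1Dx _).
Qed.

(** * Expectations over a sampling run *)

(** Conditional expectation of [G] after [n] more draws, given the history [h]; keeping [h] explicit
    permits induction on the first draw. *)
Definition run_exp (R : realType) (V : finType) (x : seq V -> V -> R) (n : nat)
    (h : seq V) (G : seq V -> R) : R :=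
  \sum_(t : n.-tuple V)
    (\prod_(i < n) x (h ++ take i t) (tnth t i)) * G (h ++ t).

Lemma run_exp0 (R : realType) (V : finType) (x : seq V -> V -> R) h G :
  run_exp x 0 h G = G h.
Proof.
rewrite /run_exp (big_pred1 [tuple]) => [|t]; last first.
  by rewrite [t]tuple0; apply/esym/eqP; apply: val_inj.
by rewrite big_ord0 mul1r cats0.
Qed.

Lemma run_expS (R : realType) (V : finType) (x : seq V -> V -> R) n h G :
  run_exp x n.+1 h G = \sum_v x h v * run_exp x n (rcons h v) G.
Proof.
(* A run of [n.+1] draws is a first element paired with a run of [n] draws. *)
rewrite /run_exp (reindex (fun p : V * n.-tuple V => cons_tuple p.1 p.2)) /=.
  rewrite -(pair_bigA _ (fun v (t : n.-tuple V) =>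
    (\prod_(i < n.+1) x (h ++ take i (cons_tuple v t)) (tnth (cons_tuple v t) i))
      * G (h ++ cons_tuple v t))) /=.
  apply: eq_bigr => v _; rewrite mulr_sumr; apply: eq_bigr => t _.
  rewrite big_ord_recl /= cats0 -mulrA cat_rcons; congr (_ * (_ * _)).
  by apply: eq_bigr => i _; rewrite cat_rcons tnthS.
exists (fun t => (thead t, behead_tuple t)) => [[v t] _|t _] /=.
  by rewrite theadE; congr (_, _); apply: val_inj.
by rewrite [RHS]tuple_eta; apply: val_inj.
Qed.

(** Iterates the supermartingale inequality; the index of [Phi] counts the draws still to come. *)
Lemma run_exp_le_potential (R : realType) (V : finType)
    (x : seq V -> V -> R) (Phi : nat -> seq V -> R) n h :
  (forall h v, 0 <= x h v) ->
  (forall n h, \sum_v x h v * Phi n (rcons h v) <= Phi n.+1 h) ->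
  run_exp x n h (Phi 0%N) <= Phi n h.
Proof.
move=> x0 step; elim: n h => [|n IH] h; first by rewrite run_exp0.
rewrite run_expS; apply: le_trans (step n h).
by apply: ler_sum => v _; rewrite ler_wpM2l.
Qed.

Lemma run_exp_cst1 (R : realType) (V : finType) (x : seq V -> V -> R) n h :
  (forall h, \sum_v x h v = 1) -> run_exp x n h (fun=> 1) = 1.
Proof.
move=> x1; elim: n h => [|n IH] h; first by rewrite run_exp0.
by rewrite run_expS -[RHS](x1 h); apply: eq_bigr => v _; rewrite IH mulr1.
Qed.

(** * Failure probability of a single repetition *)

Lemma run_set_potential_le (R : realType) (V C : finType)
    (f : C -> {set V} -> R) (B : nat) (sol : nat -> seq V -> V -> R) j c (a : R) :
  (0 < #|V|)%N -> (0 < B)%N -> monotone_fam f -> submodular_fam f ->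
  0 <= Mconst f -> 0 <= a -> valid_policy f B sol ->
  \sum_(t : B.-tuple V)
    run_prob sol j t * expR (a * (OPT f B - f c (run_set t))) <=
  expR (rate (Mconst f) B%:R a B * (OPT f B - f c set0)).
Proof.
move=> V0 B0 mf sf M0 a0 pol.
pose Phi n (h : seq V) :=
  expR (rate (Mconst f) B%:R a n * (OPT f B - f c [set v in h])).
have := @run_exp_le_potential _ _ (sol j) Phi B [::].
rewrite /Phi /= (_ : [set v in [::]] = set0); last first.
  by apply/setP => v; rewrite !inE.
apply=> [h v|n h]; first exact: (pol j h).1.1.
apply: expR_potential_step => //.
have b1 : 1 <= B%:R :> R by rewrite ler1n.
by have /andP[] := rate_bounds n M0 b1 a0.
Qed.

Lemma sum_run_prob (R : realType) (V C : finType) (f : C -> {set V} -> R)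
    (B : nat) (sol : nat -> seq V -> V -> R) j :
  valid_policy f B sol -> \sum_(t : B.-tuple V) run_prob sol j t = 1.
Proof.
move=> pol; rewrite -[RHS](@run_exp_cst1 _ _ (sol j) B [::]) => [|h].
  by apply: eq_bigr => t _; rewrite mulr1.
exact: (pol j h).1.2.
Qed.

Lemma run_prob_ge0 (R : realType) (V C : finType) (f : C -> {set V} -> R)
    (B : nat) (sol : nat -> seq V -> V -> R) j (t : B.-tuple V) :
  valid_policy f B sol -> 0 <= run_prob sol j t.
Proof. by move=> pol; apply: prodr_ge0 => i _; exact: (pol j _).1.1. Qed.

Lemma OPT_ge0 (R : realType) (V C : finType) (f : C -> {set V} -> R) B :
  (0 < #|C|)%N -> nonneg_fam f -> 0 <= OPT f B.
Proof. by move=> C0 nf; have [S _ ->] := OPT_attained f B; apply: le_minC. Qed.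

(* With [a = eps / (2 M)], the bound [rate <= a / e + a^2 M] leaves the margin
   [eps^2 OPT / (4 M) >= ln (2 k)] in the exponent. *)
Lemma run_failure_le_half (R : realType) (V C : finType)
    (f : C -> {set V} -> R) (B : nat) (eps : R)
    (sol : nat -> seq V -> V -> R) j :
  (0 < #|V|)%N -> (0 < #|C|)%N -> (0 < B)%N ->
  nonneg_fam f -> monotone_fam f -> submodular_fam f ->
  0 < eps -> 0 < Mconst f ->
  4 / eps ^+ 2 * Mconst f * ln (2 * #|C|%:R) <= OPT f B ->
  valid_policy f B sol ->
  \sum_(t : B.-tuple V |
      ~~ ((1 - expR (-1) - eps) * OPT f B <= minf f (run_set t)))
    run_prob sol j t <= 2^-1.
Proof.
move=> V0 C0 B0 nf mf sf e0 M0 HO pol.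
have O0 := OPT_ge0 B C0 nf.
set O := OPT f B in HO O0 *; set M := Mconst f in HO M0.
pose a := eps / (2 * M); set s := expR (-1).
have a0 : 0 < a by rewrite divr_gt0 // mulr_gt0.
have k0 : 0 < #|C|%:R :> R by rewrite ltr0n.
pose L := ln (2 * #|C|%:R) : R.
have LE : L <= eps ^+ 2 / (4 * M) * O.
  have p : 0 < eps ^+ 2 / (4 * M) by rewrite divr_gt0 ?exprn_gt0 // mulr_gt0.
  have := ler_wpM2l (ltW p) HO; rewrite -/L.
  rewrite (_ : eps ^+ 2 / (4 * M) * (_ * L) = L) //; field; by rewrite !gt_eqF.
(* The exponent in Markov's inequality: the initial potential against the deficit [(s + eps) * O]
   that a failing color exceeds. *)
have rO c : rate M B%:R a B * (O - f c set0) - a * ((s + eps) * O) <= - L.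
  have b1 : 1 <= B%:R :> R by rewrite ler1n.
  have /andP[r0 _] := rate_bounds B (ltW M0) b1 (ltW a0).
  have rle : rate M B%:R a B <= a * s + a ^+ 2 * M.
    apply: le_trans (rate_le B (ltW M0) b1 (ltW a0)) _.
    have qs := expr_1subV_le_expRN1 R B0.
    have q0 : 0 <= (1 - B%:R^-1) ^+ B :> R.
      by rewrite exprn_ge0 // subr_ge0 invf_le1 // ltr0n.
    apply: lerD; first by rewrite ler_wpM2l // ltW.
    rewrite ler_piMr //; last by lra.
    by rewrite mulr_ge0 ?sqr_ge0 // ltW.
  have H1 : rate M B%:R a B * (O - f c set0) <= rate M B%:R a B * O.
    by rewrite ler_wpM2l // gerBl.
  have H2 := ler_wpM2r O0 rle.
  (* The choice of [a] maximizes [a * eps - a^2 * M], with value [eps^2 / (4 * M)]. *)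
  have E : (a * s + a ^+ 2 * M) * O - a * ((s + eps) * O)
         = - (eps ^+ 2 / (4 * M) * O).
    by rewrite /a; field; rewrite gt_eqF.
  by lra.
(* Markov weight: at least 1 whenever color [c] fails, so summing it over the colors is the union
   bound. *)
pose W c (t : B.-tuple V) :=
  expR (a * (O - f c (run_set t))) * expR (- (a * ((s + eps) * O))).
apply: (@le_trans _ _
    (\sum_(t : B.-tuple V) \sum_c run_prob sol j t * W c t)).
  rewrite big_mkcond /=; apply: ler_sum => t _.
  have p0 := run_prob_ge0 j t pol.
  have W0 c : 0 <= run_prob sol j t * W c t.
    by rewrite mulr_ge0 // mulr_ge0 // expR_ge0.
  case: ifPn => [bad|_]; last exact: sumr_ge0.
  have [c fc] : exists c, f c (run_set t) < (1 - s - eps) * O.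
    apply/existsP; apply: contraNT bad => /existsPn H.
    by apply: le_minC => // c; rewrite leNgt.
  rewrite (bigD1 c) //= ler_wpDr ?sumr_ge0 // ler_peMr //.
  rewrite /W -expRD -expR0 ler_expR -mulrBr mulr_ge0 ?(ltW a0) //.
  by move: fc; lra.
rewrite exchange_big /=.
apply: (@le_trans _ _ (\sum_(c : C) (2 * #|C|%:R)^-1)); last first.
  rewrite sumr_const -[leLHS]mulr_natr invfM -mulrA mulVf ?mulr1 //.
  by rewrite gt_eqF.
apply: ler_sum => c _.
under eq_bigr do rewrite mulrA; rewrite -mulr_suml.
have H := run_set_potential_le j c V0 B0 mf sf (ltW M0) (ltW a0) pol.
apply: le_trans (ler_wpM2r (expR_ge0 _) H) _.
(* The target [1 / (2 k)] is written as [expR (- L)] to compare exponents. *)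
rewrite -expRD -[X in _ <= X]lnK ?posrE ?invr_gt0 ?mulr_gt0 // ler_expR.
by rewrite lnV ?posrE ?mulr_gt0 //; exact: rO.
Qed.

(** * Best of the independent repetitions *)

Lemma foldl_best_ge (R : realType) (T : eqType) (g : T -> R)
    (s : seq T) (x y : T) :
  y \in x :: s ->
  g y <= g (foldl (fun b z => if g b <= g z then z else b) x s).
Proof.
elim: s x y => [|z s IH] x y /=; first by rewrite inE => /eqP->.
rewrite !inE orbA => /orP[/orP[]/eqP->|ys].
- case: ifP => [xz|_]; last by apply: IH; rewrite inE eqxx.
  by apply: le_trans xz _; apply: IH; rewrite inE eqxx.
- case: ifPn => [_|]; first by apply: IH; rewrite inE eqxx.
  rewrite -ltNge => /ltW zx.
  by apply: le_trans zx _; apply: IH; rewrite inE eqxx.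
- by apply: IH; rewrite inE ys orbT.
Qed.

Lemma foldl_best_mem (R : realType) (T : eqType) (g : T -> R)
    (s : seq T) (x : T) :
  foldl (fun b z => if g b <= g z then z else b) x s \in x :: s.
Proof.
elim: s x => [|z s IH] x /=; first by rewrite inE.
case: ifP => _; first by rewrite inE IH orbT.
by have := IH x; rewrite !inE => /orP[]->; rewrite ?orbT.
Qed.

(** The output is [set0] or the set of some run, and [B] draws contain at most [B] distinct
    elements. *)
Lemma card_alg_output (R : realType) (V C : finType) (f : C -> {set V} -> R)
    B n (w : {ffun 'I_n -> B.-tuple V}) : (#|alg_output f w| <= B)%N.
Proof.
have := foldl_best_mem (minf f) [seq run_set (w j) | j <- enum 'I_n] set0.
rewrite inE => /orP[/eqP|/mapP[j _]]; rewrite /alg_output => ->.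
  by rewrite cards0.
by rewrite cardsE (leq_trans (card_size _)) // size_tuple.
Qed.

Lemma minf_alg_output_ge (R : realType) (V C : finType) (f : C -> {set V} -> R)
    B n (w : {ffun 'I_n -> B.-tuple V}) j :
  minf f (run_set (w j)) <= minf f (alg_output f w).
Proof.
apply: (foldl_best_ge (minf f)); rewrite inE; apply/orP; right.
by apply/mapP; exists j; rewrite ?mem_enum.
Qed.

Lemma half_expr_nreps_le (R : realType) (delta : R) :
  0 < delta -> delta < 1 -> 2^-1 ^+ nreps delta <= delta.
Proof.
move=> d0 d1.
have l2 : 0 < ln 2 :> R by rewrite ln_gt0 // ltr1n.
have q0 : 0 < 2 / delta by rewrite divr_gt0.
have H : ln (2 / delta) / ln 2 <= (nreps delta)%:R.
  apply: le_trans (ceil_ge _) _; rewrite /nreps natr_absz ler_int.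
  exact: ler_norm.
rewrite ler_pdivrMr // (mulr_natl (ln 2)) -lnXn // ler_ln ?posrE ?exprn_gt0 // in H.
rewrite exprVn -[leRHS]invrK lef_pV2 ?posrE ?invr_gt0 ?exprn_gt0 //.
(* The number of repetitions would even yield [delta / 2]; the factor 2 is given away here. *)
apply: le_trans H; rewrite ler_peMl ?invr_ge0 ?(ltW d0) //.
by rewrite ler1n.
Qed.

Theorem theorem1 (R : realType) (V C : finType)
  (f : C -> {set V} -> R) (B : nat) (eps delta : R)
  (sol : nat -> seq V -> V -> R) :
  (0 < #|V|)%N -> (0 < #|C|)%N -> (0 < B)%N ->
  nonneg_fam f -> monotone_fam f -> submodular_fam f ->
  0 < eps -> 0 < delta -> delta < 1 ->
  0 < Mconst f ->
  OPT f B >= 4 / eps ^+ 2 * Mconst f * ln (2 * #|C|%:R) ->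
  valid_policy f B sol ->
  alg_prob f B delta sol
    (fun S => (#|S| <= B)%N && ((1 - expR (-1) - eps) * OPT f B <= minf f S))
  >= 1 - delta.
Proof.
move=> V0 C0 B0 nf mf sf e0 d0 d1 M0 HO pol.
rewrite /alg_prob; set n := nreps delta; set thr := _ * OPT f B.
have tot : \sum_(w : {ffun 'I_n -> B.-tuple V}) outcome_prob sol w = 1.
  rewrite /outcome_prob -(bigA_distr_bigA (fun j : 'I_n => @run_prob R V B sol j)).
  by rewrite big1 // => j _; exact: sum_run_prob pol.
have op0 (w : {ffun 'I_n -> B.-tuple V}) : 0 <= outcome_prob sol w.
  by apply: prodr_ge0 => j _; exact: run_prob_ge0 pol.
(* Since the total mass is 1, it suffices to bound the complementary event by [delta]. *)
rewrite -tot (bigID (fun w =>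
  (#|alg_output f w| <= B)%N && (thr <= minf f (alg_output f w)))) /=.
rewrite lerBlDr lerD2l.
apply: le_trans (half_expr_nreps_le d0 d1); rewrite -/n.
(* The size bound always holds and the output is at least as good as every run, so failure forces
   all runs to be bad. *)
pose bad (t : B.-tuple V) := ~~ (thr <= minf f (run_set t)).
apply: (@le_trans _ _
    (\sum_(w in ffun_on bad) @outcome_prob R V B n sol w)).
  rewrite big_mkcond [leRHS]big_mkcond /=; apply: ler_sum => w _.
  case: ifPn => [nb|_]; last by case: ifP.
  rewrite ifT //; apply/ffun_onP => j; rewrite unfold_in /bad.
  apply: contraNN nb => gj; rewrite card_alg_output /=.
  exact: le_trans gj (minf_alg_output_ge f w j).
(* Independence: the mass of a product event factors over the repetitions. *)
rewrite /outcome_prob -(bigA_distr_big bad (fun j : 'I_n => @run_prob R V B sol j)).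
rewrite -[in X in _ <= _ ^+ X](card_ord n) -prodr_const; apply: ler_prod => j _.
rewrite sumr_ge0 => [|t _]; last exact: run_prob_ge0 pol.
exact: run_failure_le_half pol.
Qed.
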